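(* Let $A$ be a unital Banach $\star$-algebra with unity $1$, let $z \in A$ be fixed, let $X$ be a Banach space, and let $\phi : A \times A \to X$ be a continuous bilinear map such that \[ \phi(a, b^\star) = \phi(z, 1) \quad \text{for all } a, b \in A \text{ with } a b^\star = z. \] Then \[ \phi(za, a) = \phi(z a^2, 1) \quad \text{and} \quad \phi(za, 1) = \phi(z, a) \quad \text{for all } a \in A, \] and there exists a continuous linear map $\Phi : A \to X$ such that \[ \phi(za, b) + \phi(zb, a) = \Phi(a \circ b) \quad \text{for all } a, b \in A. \]
   Context: Algebras and Banach spaces are over $\mathbb{C}$; $a \mapsto a^\star$ denotes the involution of $A$ (conjugate-linear, anti-multiplicative, and $(a^\star)^\star = a$). The Jordan product on $A$ is $a \circ b = ab + ba$. *)

(* Defs.v *)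
From HB Require Import structures.
From mathcomp Require Import all_boot all_order all_algebra.
From mathcomp Require Import all_classical all_reals all_analysis.
From mathcomp Require Import complex.

Set Implicit Arguments.
Unset Strict Implicit.
Unset Printing Implicit Defensive.

Import Order.TTheory GRing.Theory Num.Theory.
Import numFieldNormedType.Exports.
Local Open Scope ring_scope.

(* A Hierarchy-Builder structure joining GRing.PzRing and NormedModule K cannot
   be declared: Num.NumDomain already inherits from rings and normed Z-modules,
   with the norm valued in the ring itself.  So the product is given by a record
   over a Banach space, and the alias balg_sort carries the ring structure.
   The norm of 1 is not normalized, and the zero algebra is allowed. *)
Record banachAlgType (K : numFieldType) := BanachAlg {
  balg_space : completeNormedModType K;
  balg_one : balg_space;
  balg_mul : balg_space -> balg_space -> balg_space;
  balg_mulA : associative balg_mul;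
  balg_mul1x : left_id balg_one balg_mul;
  balg_mulx1 : right_id balg_one balg_mul;
  balg_mulDl : left_distributive balg_mul +%R;
  balg_mulDr : right_distributive balg_mul +%R;
  balg_scaleAl : forall (c : K) (a b : balg_space),
    c *: balg_mul a b = balg_mul (c *: a) b;
  balg_scaleAr : forall (c : K) (a b : balg_space),
    c *: balg_mul a b = balg_mul a (c *: b);
  balg_norm_mul : forall a b : balg_space, `|balg_mul a b| <= `|a| * `|b|
}.

Definition balg_sort (K : numFieldType) (A : banachAlgType K) : Type :=
  balg_space A.
Coercion balg_sort : banachAlgType >-> Sortclass.

HB.instance Definition _ (K : numFieldType) (A : banachAlgType K) :=
  CompleteNormedModule.copy (balg_sort A) (balg_space A).
HB.instance Definition _ (K : numFieldType) (A : banachAlgType K) :=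
  GRing.Zmodule_isPzRing.Build (balg_sort A) (@balg_mulA K A)
    (@balg_mul1x K A) (@balg_mulx1 K A) (@balg_mulDl K A) (@balg_mulDr K A).

(* The involution is not assumed to be isometric or continuous. *)
Record banachStarAlgType (K : numClosedFieldType) := BanachStarAlg {
  star_balg :> banachAlgType K;
  star : star_balg -> star_balg;
  starD : forall a b : star_balg, star (a + b) = star a + star b;
  starZ : forall (c : K) (a : star_balg), star (c *: a) = c^* *: star a;
  starM : forall a b : star_balg, star (a * b) = star b * star a;
  starK : forall a : star_balg, star (star a) = a
}.

(* The Jordan product is taken without the factor 1/2. *)
Definition jordan_mul (A : pzRingType) (a b : A) : A := a * b + b * a.

(* Main.v *)
Require Import Defs.
From HB Require Import structures.
From mathcomp Require Import all_boot all_order all_algebra.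
From mathcomp Require Import all_classical all_reals all_analysis.
From mathcomp Require Import complex.

Set Implicit Arguments.
Unset Strict Implicit.
Unset Printing Implicit Defensive.

Import Order.TTheory GRing.Theory Num.Theory.
Import numFieldNormedType.Exports.
Local Open Scope ring_scope.

(** The involution is onto, so the hypothesis says that [phi x y = phi z 1]
    whenever [x * y = z].  Fix [a] and let [v] be the inverse of [1 - t a] for a
    small scalar [t > 0].  Then [z (1 - t a) v = z], so
      [phi z v - t phi (z a) v = phi z 1].
    Expanding [v = 1 + t a + t^2 a^2 + ...] and comparing the coefficients of
    [t] gives [phi z (a ^ n.+1) = phi (z a) (a ^ n)] for every [n]; this is
    [resolvent_coefficients].  The cases [n = 0] and [n = 1] read
      [phi z a = phi (z a) 1]  and  [phi z (a ^ 2) = phi (z a) a],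
    and the former at [a ^ 2] turns the latter into
    [phi (z a) a = phi (z a ^ 2) 1].  Polarizing the quadratic identity
    [phi (z a) a = phi z (a ^ 2)] shows that [Phi = phi z] satisfies the last
    claim.

    The comparison rests on the equation [v = 1 + t a v], used repeatedly, and
    on a bound on [v] uniform in [t], which makes every remainder [O(t)].
    Existence of [v] is where completeness of [A] enters, through the geometric
    series ([resolvent_exists]). *)

(** * Limits along small positive scalars *)

(** The limit [t -> 0], in the form that extracts the constant term of an
    expansion in [t]. *)
Lemma eq0_of_norm_le_small (K : numFieldType) (V : normedModType K) (p : V)
    (d C : K) :
  0 < d -> (forall t : K, 0 < t -> t <= d -> `|p| <= t * C) -> p = 0.
Proof.
move=> d0 pC; apply/eqP; apply: contraT; rewrite -normr_gt0 => p0.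
have dC0 : 0 < d * C by apply: lt_le_trans (pC d d0 (lexx d)).
have D0 : 0 < `|p| + d * C by rewrite addr_gt0.
(* Here t * C = `|p| * (d C / (`|p| + d C)) is strictly below `|p|. *)
pose t := d * (`|p| / (`|p| + d * C)).
have t0 : 0 < t by rewrite !mulr_gt0 ?invr_gt0.
have td : t <= d.
  rewrite ger_pMr // ler_pdivrMr // mul1r lerDl.
  exact: ltW dC0.
have tC : t * C = `|p| * (d * C / (`|p| + d * C)).
  by rewrite /t mulrCA -[LHS]mulrA [in LHS]mulrAC.
have := pC t t0 td; rewrite tC ler_pMr //.
by rewrite ler_pdivlMr ?mul1r // gerDr => /(lt_le_trans p0); rewrite ltxx.
Qed.

(** Positive elements of [R[i]] are real, so this reduces to the archimedean
    property of [R]. *)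
Lemma exp_half_lt (R : realType) (e : R[i]) :
  0 < e -> exists n : nat, 2^-1 ^+ n < e.
Proof.
case: e => r s; rewrite ltcE /= => /andP[/eqP-> r0].
exists (Num.bound r^-1).
have -> : (2^-1 : R[i]) = (2^-1 : R)%:C%C by rewrite fmorphV rmorph_nat.
rewrite -rmorphXn /= ltcR exprVn invf_plt ?posrE ?exprn_gt0 //.
apply: lt_trans (archi_boundP _) _; first by rewrite invr_ge0 ltW.
by rewrite -natrX ltr_nat ltn_expl.
Qed.

(** * Banach algebras *)

Section BanachAlgebra.
Variables (K : numFieldType) (A : banachAlgType K).
Implicit Types (c : K) (a b x : A).

Lemma banach_mulZl c a b : (c *: a) * b = c *: (a * b).
Proof. by rewrite [RHS]balg_scaleAl. Qed.

Lemma banach_mulZr c a b : a * (c *: b) = c *: (a * b).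
Proof. by rewrite [RHS]balg_scaleAr. Qed.

Lemma banach_normM a b : `|a * b| <= `|a| * `|b|.
Proof. exact: balg_norm_mul. Qed.

(** A named operator, to carry the linear structure of left multiplication. *)
Definition lmul a : A -> A := fun b => a * b.

Fact lmul_is_linear a : linear (lmul a).
Proof. by move=> c x y; rewrite /lmul mulrDr banach_mulZr. Qed.

HB.instance Definition _ a :=
  GRing.isLinear.Build K A A *:%R (lmul a) (lmul_is_linear a).

Lemma lmul_continuous a : continuous (lmul a).
Proof.
apply: bounded_linear_continuous; apply/linear_boundedP.
near=> r => x; apply: le_trans (banach_normM a x) _.
by rewrite ler_wpM2r //; near: r; apply: nbhs_pinfty_ge; rewrite normr_real.
Unshelve. all: by end_near. Qed.

(** Here [x v] has at most half the norm of [v], so the bound on [v] does not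
    depend on [x]. *)
Lemma resolvent_norm_le x v :
  `|x| <= 2^-1 -> v = 1 + x * v -> `|v| <= `|1 : A| *+ 2.
Proof.
move=> x2 vE; have : `|v| <= `|1 : A| + `|v| / 2.
  rewrite {1}vE (le_trans (ler_normD _ _)) // lerD2l.
  by rewrite (le_trans (banach_normM _ _)) // mulrC ler_wpM2l.
rewrite -lerBlDr => h.
have vv : `|v| - `|v| / 2 = `|v| / 2 by rewrite {1}[`|v|]splitr addrK.
by move: h; rewrite vv ler_pdivrMr // mulr_natr.
Qed.

End BanachAlgebra.

(** * Inverses of elements near the unit *)

Section Neumann.
Variables (R : realType) (A : banachAlgType R[i]).
Implicit Types a x : A.

Let partial_sum x n : A := \sum_(k < n) x ^+ k.

Let partial_sumS x n : partial_sum x n.+1 = 1 + x * partial_sum x n.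
Proof.
rewrite /partial_sum big_ord_recl expr0 mulr_sumr; congr (_ + _).
by apply: eq_bigr => k _; rewrite exprS.
Qed.

Let partial_sumD x n m :
  partial_sum x (n + m) - partial_sum x n = x ^+ n * partial_sum x m.
Proof.
rewrite /partial_sum big_split_ord /= addrC addrK mulr_sumr.
by apply: eq_bigr => k _; rewrite exprD.
Qed.

Let partial_sum_norm x n : `|x| <= 2^-1 -> `|partial_sum x n| <= `|1 : A| *+ 2.
Proof.
move=> x2; elim: n => [|n ih].
  by rewrite /partial_sum big_ord0 normr0 mulrn_wge0.
rewrite partial_sumS (le_trans (ler_normD _ _)) // [leRHS]mulr2n lerD2l.
rewrite (le_trans (banach_normM _ _)) //.
rewrite (le_trans (ler_pM _ _ x2 ih)) //.
by rewrite ler_pdivrMl // mulr_natl.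
Qed.

Let exp_mul_norm x n v : `|x| <= 2^-1 -> `|x ^+ n * v| <= 2^-1 ^+ n * `|v|.
Proof.
move=> x2; elim: n => [|n ih]; first by rewrite expr0 mul1r mul1r.
rewrite exprS -mulrA (le_trans (banach_normM _ _)) //.
by rewrite [_ ^+ n.+1]exprS -mulrA ler_pM.
Qed.

(** Neumann series: the partial sums [s n] of [1 + x + x ^ 2 + ...] satisfy
    [s n.+1 = 1 + x (s n)] and are Cauchy because the difference of two of them
    is [x ^ n] times a third, hence at most [2^-n] times a fixed constant. *)
Lemma resolvent_exists x : `|x| <= 2^-1 -> exists v, v = 1 + x * v.
Proof.
move=> x2.
(* The summand 1 keeps the constant positive when A is the zero algebra. *)
have C0 : 0 < `|1 : A| *+ 2 + 1 by rewrite ltr_wpDl // mulrn_wge0.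
have s_cvg : cvgn (partial_sum x).
  apply/cauchy_cvgP/cauchy_exP => e e0.
  have [n ne] : exists n : nat, 2^-1 ^+ n < e / (`|1 : A| *+ 2 + 1).
    by apply: exp_half_lt; rewrite divr_gt0.
  exists (partial_sum x n); exists n => // m /= nm.
  rewrite -ball_normE /= distrC -(subnKC nm) partial_sumD.
  rewrite (le_lt_trans (exp_mul_norm _ _ x2)) //.
  rewrite (@le_lt_trans _ _ (2^-1 ^+ n * (`|1 : A| *+ 2 + 1))) //.
    rewrite ler_wpM2l ?exprn_ge0 //.
    by rewrite (le_trans (partial_sum_norm _ x2)) // lerDl.
  by rewrite -ltr_pdivlMr.
exists (limn (partial_sum x)).
have lim_shift :
    (partial_sum x n.+1 @[n --> \oo] --> limn (partial_sum x))%classic.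
  by have := s_cvg; rewrite -[X in X -> _](cvg_shiftS (partial_sum x)).
have lim_rec :
    (partial_sum x n.+1 @[n --> \oo] --> 1 + x * limn (partial_sum x))%classic.
  under eq_cvg do rewrite partial_sumS.
  apply: cvgD; first exact: cvg_cst.
  exact: cvg_comp s_cvg (@lmul_continuous _ _ x _).
exact: (cvg_unique (@norm_hausdorff _ A) lim_shift lim_rec).
Qed.

End Neumann.

(** * Comparison of coefficients *)

Section Coefficients.
Variables (R : realType) (A : banachAlgType R[i]) (X : normedModType R[i]).

(** With [v = \sum_n t^n a^n], the hypothesis is an identity between power
    series in [t], and the conclusion equates the coefficients of [t^(n + 1)].
    The proof peels off one coefficient at a time: the remainders satisfy
    [f (a ^ n.+1 v) = g (a ^ n v)]; letting [t] tend to [0] gives the [n]-th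
    identity; subtracting it and dividing by [t] gives the next remainders. *)
Lemma resolvent_coefficients (f g : {linear A -> X}) (a : A) :
    continuous f -> continuous g ->
    (forall t v, (1 - t *: a) * v = 1 -> f v - t *: g v = f 1) ->
  forall n, f (a ^+ n.+1) = g (a ^+ n).
Proof.
move=> fc gc fgE.
(* For 0 < t <= d the norm of t *: a is at most one half. *)
pose d : R[i] := (2 * (`|a| + 1))^-1.
have d0 : 0 < d by rewrite invr_gt0 mulr_gt0 // ltr_wpDl.
have resolvent t : 0 < t -> t <= d -> exists v, v = 1 + t *: (a * v) /\
    `|v| <= `|1 : A| *+ 2.
  move=> t0 td.
  have ta : `|t *: a| <= 2^-1.
    rewrite normrZ gtr0_norm // (le_trans (ler_wpM2r _ td)) // /d invfM -mulrA.
    by rewrite ger_pMr ?invr_gt0 // mulrC ler_pdivrMr ?mul1r ?lerDl // ltr_wpDl.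
  have [v vE] := resolvent_exists ta.
  exists v; split; first by rewrite {1}vE banach_mulZl.
  exact: resolvent_norm_le ta vE.
have norm_bound (h : {linear A -> X}) :
    continuous h -> exists2 C : R[i], 0 <= C & forall x, `|h x| <= C * `|x|.
  move=> /(_ 0)/continuous_linear_bounded/linear_boundedP.
  by move=> /pinfty_ex_gt0[C /ltW C0 hC]; exists C.
have [F F0 fF] := norm_bound f fc.
have [G G0 gG] := norm_bound g gc.
have pow_rec n t v : v = 1 + t *: (a * v) ->
    a ^+ n * v = a ^+ n + t *: (a ^+ n.+1 * v).
  by move=> {1}->; rewrite mulrDr mulr1 banach_mulZr mulrA -exprSr.
have expand t v n : v = 1 + t *: (a * v) ->
    f (a ^+ n.+1 * v) = g (a ^+ n * v) ->
    f (a ^+ n.+1) + t *: f (a ^+ n.+2 * v) =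
      g (a ^+ n) + t *: g (a ^+ n.+1 * v).
  by move=> vE; rewrite -!linearZ_LR -!linearD -!pow_rec.
have pow_lim n :
    (forall t v, 0 < t -> t <= d -> v = 1 + t *: (a * v) ->
      f (a ^+ n.+1 * v) = g (a ^+ n * v)) -> f (a ^+ n.+1) = g (a ^+ n).
  move=> fgv; apply/eqP; rewrite -subr_eq0; apply/eqP.
  (* The difference equals t *: (g (a ^+ n.+1 * v) - f (a ^+ n.+2 * v)), and C
     bounds the second factor uniformly in t. *)
  pose C := F * (`|a ^+ n.+2| * (`|1 : A| *+ 2))
          + G * (`|a ^+ n.+1| * (`|1 : A| *+ 2)).
  apply: (@eq0_of_norm_le_small _ _ _ d C) => // t t0 td.
  have [v [vE v2]] := resolvent t t0 td.
  have -> : f (a ^+ n.+1) - g (a ^+ n) =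
      t *: (g (a ^+ n.+1 * v) - f (a ^+ n.+2 * v)).
    rewrite scalerBr -[f (a ^+ n.+1)](addrK (t *: f (a ^+ n.+2 * v))).
    rewrite (expand t v n vE (fgv t v t0 td vE)).
    by rewrite addrAC [g _ + _]addrC addrK.
  rewrite normrZ gtr0_norm // ler_wpM2l ?(ltW t0) //.
  rewrite (le_trans (ler_normB _ _)) // addrC lerD //.
    rewrite (le_trans (fF _)) // ler_wpM2l // (le_trans (banach_normM _ _)) //.
    by rewrite ler_wpM2l.
  rewrite (le_trans (gG _)) // ler_wpM2l // (le_trans (banach_normM _ _)) //.
  by rewrite ler_wpM2l.
move=> n; apply: (pow_lim n); elim: n => [|n ih] t v t0 td vE.
  have tn0 : t != 0 by rewrite gt_eqF.
  apply: (scalerI tn0); rewrite expr0 expr1 mul1r.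
  have inv : (1 - t *: a) * v = 1.
    by rewrite mulrBl mul1r banach_mulZl {1}vE addrK.
  have fv : f v = f 1 + t *: f (a * v) by rewrite -linearZ_LR -linearD -vE.
  apply/eqP; rewrite -subr_eq0; apply/eqP/(addrI (f 1)).
  by rewrite addr0 addrA -fv; exact: fgE.
have tn0 : t != 0 by rewrite gt_eqF.
have := expand t v n vE (ih t v t0 td vE).
by rewrite (pow_lim n ih) => /addrI/(scalerI tn0).
Qed.

End Coefficients.

Theorem theorem3p1 (R : realType) (A : banachStarAlgType R[i]) (z : A)
    (X : completeNormedModType R[i]) (phi : {bilinear A -> A -> X})
    (phi_cont : continuous (fun p : A * A => phi p.1 p.2))
    (phi_z : forall a b : A, a * star b = z -> phi a (star b) = phi z 1) :
  (forall a : A, phi (z * a) a = phi (z * a ^+ 2) 1 /\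
                 phi (z * a) 1 = phi z a) /\
  (exists Phi : {linear A -> X}, continuous Phi /\
     forall a b : A, phi (z * a) b + phi (z * b) a = Phi (jordan_mul a b)).
Proof.
have phi_fact x y : x * y = z -> phi x y = phi z 1.
  by rewrite -(starK y); exact: phi_z.
have phi_contr x : continuous (phi x).
  move=> y; apply: (@continuous_comp _ _ _ (fun y : A => (x, y))
    (fun p : A * A => phi p.1 p.2)); last exact: phi_cont.
  by apply: cvg_pair; [exact: cvg_cst | exact: cvg_id].
have phi_pow a n : phi z (a ^+ n.+1) = phi (z * a) (a ^+ n).
  apply: (resolvent_coefficients (phi_contr z) (phi_contr (z * a))) => t v tv.
  have zv : z * (1 - t *: a) * v = z by rewrite -mulrA tv mulr1.
  rewrite /= -(phi_fact _ _ zv) mulrBr mulr1 banach_mulZr.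
  by rewrite linearBl linearZl_LR.
have phi1 a : phi (z * a) 1 = phi z a by rewrite -(phi_pow a 0%N) expr1.
have phi2 a : phi (z * a) a = phi z (a ^+ 2).
  by rewrite (phi_pow a 1%N) expr1.
split=> [a|]; first by rewrite phi1 phi2.
exists (phi z); split=> [|a b]; first exact: phi_contr.
rewrite /= /jordan_mul.
have := phi2 (a + b); rewrite expr2 mulrDl !mulrDr linearDl !linearDr /=.
rewrite !phi2 -!expr2 -!addrA => /addrI.
by rewrite !addrA => /addIr.
Qed.
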